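(* For every graph $G$, $\chi^\star_\ell(G) \le 1+\Delta(G) + \chi_\ell(G)$.
   Context: Graphs are finite and simple; $\Delta(G)$ is the maximum degree of $G$. A list-assignment $L$ of $G$ maps each vertex $v\in V(G)$ to a set $L(v)\subseteq\mathbb{N}$ of colours; it is a $k$-list-assignment if $|L(v)|=k$ for every $v$. A proper $L$-colouring is a map $c:V(G)\to\mathbb{N}$ with $c(v)\in L(v)$ for all $v$ and $c(u)\neq c(v)$ for every edge $uv$. The list chromatic number $\chi_\ell(G)$ is the least $k$ such that $G$ admits a proper $L$-colouring for every $k$-list-assignment $L$ of $G$. A proper $L$-packing of $G$ of size $k$ is a collection of $k$ proper $L$-colourings $c_1,\dots,c_k$ that are mutually disjoint, i.e. $c_i(v)\neq c_j(v)$ for all $i\neq j$ and all $v\in V(G)$. The list packing number $\chi^\star_\ell(G)$ is the least $k$ such that $G$ admits a proper $L$-packing of size $k$ for every $k$-list-assignment $L$ of $G$. *)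

(* Defs.v *)
From mathcomp Require Import all_boot all_fingroup finmap.
From mathcomp Require Import boolp.

Set Implicit Arguments.
Unset Strict Implicit.
Unset Printing Implicit Defensive.

Record sgraph := SGraph {
  vertex :> finType;
  edge : rel vertex;
  edge_sym : symmetric edge;
  edge_irrefl : irreflexive edge
}.

Definition degree (G : sgraph) (v : G) : nat := #|[set u : G | edge v u]|.

Definition max_degree (G : sgraph) : nat := \max_(v : G) degree v.

Definition list_assignment (G : sgraph) : Type := G -> {fset nat}.

Definition k_list_assignment (G : sgraph) (k : nat)
    (L : list_assignment G) : Prop :=
  forall v : G, #|` L v| = k.

Definition proper_list_colouring (G : sgraph) (L : list_assignment G)
    (c : G -> nat) : Prop :=
  (forall v : G, c v \in L v) /\ (forall u v : G, edge u v -> c u != c v).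

Definition proper_list_packing (G : sgraph) (L : list_assignment G) (k : nat)
    (c : 'I_k -> G -> nat) : Prop :=
  (forall i : 'I_k, proper_list_colouring L (c i)) /\
  (forall (i j : 'I_k) (v : G), i != j -> c i v != c j v).

Definition list_colourable (G : sgraph) (k : nat) : Prop :=
  forall L : list_assignment G, k_list_assignment k L ->
    exists c : G -> nat, proper_list_colouring L c.

Definition list_packable (G : sgraph) (k : nat) : Prop :=
  forall L : list_assignment G, k_list_assignment k L ->
    exists c : 'I_k -> G -> nat, proper_list_packing L c.

(* The facts up to [list_colourable_ex] only show that [list_packable G k]   *)
(* and [list_colourable G k] hold for some k > 0, so that the minima below   *)
(* are attained.                                                             *)

Fact avoiding_perm (k m : nat) (F : rel 'I_k) :
    (forall i, #|[set x | F i x]| <= m) ->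
    (forall x, #|[set i | F i x]| <= m) ->
    m.*2 < k ->
  exists p : {perm 'I_k}, forall i, ~~ F i (p i).
Proof.
move=> Frow Fcol ltmk.
pose bad (p : {perm 'I_k}) := [set i | F i (p i)].
have [p _ pmin] := @arg_minnP _ (1%g : {perm 'I_k}) xpredT (fun p => #|bad p|) isT.
exists p => i0; apply/negP => Fi0.
pose A := [set j | F i0 (p j)]; pose B := [set j | F j (p i0)].
have leA : #|A| <= m.
  have -> : A = p @^-1: [set x | F i0 x] by apply/setP => j; rewrite !inE.
  by rewrite card_preimset //; apply: perm_inj.
have [j] : exists j, j \notin A :|: B.
  apply/existsP; rewrite -negb_forall; apply/negP => /forallP allAB.
  suff : k <= m.*2 by rewrite leqNgt ltmk.
  rewrite -[X in X <= _]card_ord -cardsT -addnn.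
  apply: leq_trans (leq_add leA (Fcol (p i0))).
  apply: leq_trans (leq_card_setU A B).
  by apply/subset_leq_card/subsetP => j _; apply: allAB.
rewrite !inE negb_or => /andP[nFA nFB].
have := pmin (tperm i0 j * p)%g isT; rewrite leqNgt => /negP; apply.
apply/proper_card/properP; split; last first.
  by exists i0; rewrite !inE ?permM ?tpermL.
apply/subsetP => i; rewrite !inE permM.
by case: tpermP => [->|->|//]; rewrite ?(negbTE nFA) ?(negbTE nFB).
Qed.

Fact card_has_functional (I : finType) (U : Type) (R : I -> U -> bool)
    (s : seq U) :
    (forall u i j, R i u -> R j u -> i = j) ->
  #|[set i | has (R i) s]| <= size s.
Proof.
move=> Rfun; elim: s => [|u s IHs] /=.
  by rewrite leqn0 cards_eq0; apply/eqP/setP => i; rewrite !inE.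
have -> : [set i | R i u || has (R i) s] =
    [set i | R i u] :|: [set i | has (R i) s].
  by apply/setP => i; rewrite !inE.
apply: leq_trans (leq_card_setU _ _) _; rewrite -add1n leq_add //.
by apply/card_le1P => i; rewrite inE => Ri j; rewrite !inE;
  apply/idP/eqP => [Rj|->//]; apply: Rfun Rj Ri.
Qed.

Fact list_packable_double (G : sgraph) : list_packable G #|G|.*2.+1.
Proof.
set k := _.+1 => L Lk.
suff [c [cL cD cP]] : exists c : 'I_k -> G -> nat, [/\
    forall i u, u \in enum G -> c i u \in L u,
    forall i j u, u \in enum G -> i != j -> c i u != c j u &
    forall i, {in enum G &, forall u w, u != w -> c i u != c i w}].
  have inG u : u \in enum G by rewrite mem_enum.
  exists c; split=> [i|i j v]; last exact: cD.
  split=> [v|u v uv]; first exact: cL.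
  by apply: cP => //; apply: contraTneq uv => ->; rewrite edge_irrefl.
have : size (enum G) <= #|G| by rewrite -cardE.
elim: (enum G) => [_|v s IHs /= ltsG]; first by exists (fun _ _ => 0); split.
have [c [cL cD cP]] := IHs (ltnW ltsG).
have [vs|vNs] := boolP (v \in s).
  have insE u : (u \in v :: s) = (u \in s).
    by rewrite inE; case: eqP => // ->; rewrite vs.
  exists c; split=> [i u|i j u|i u w]; rewrite !insE; first exact: cL.
    exact: cD.
  exact: cP.
pose g (x : 'I_k) := nth 0 (L v) x.
have gL x : g x \in L v by apply: mem_nth; rewrite -/(size _) Lk.
have g_inj : injective g.
  move=> x y /eqP; rewrite nth_uniq ?fset_uniq ?Lk // => /eqP.
  exact: val_inj.
have [||| p pP] := @avoiding_perm k (size s)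
    (fun i x => has (fun u => c i u == g x) s).
- move=> i; apply: card_has_functional => u x y /eqP -> /eqP.
  exact: g_inj.
- move=> x.
  have -> : [set i | has (fun u => c i u == g x) s] =
      [set i | has (fun u => (u \in s) && (c i u == g x)) s].
    by apply/setP => i; rewrite !inE; apply: eq_in_has => u ->.
  apply: (@card_has_functional _ _ (fun i u => (u \in s) && (c i u == g x))).
  move=> u i j /andP[us /eqP ci] /andP[_ /eqP cj]; apply/eqP/negPn/negP.
  by move=> /(cD _ _ _ us); rewrite ci cj eqxx.
- by rewrite ltnS leq_double ltnW.
have {}pP i u : u \in s -> c i u != g (p i).
  by move=> us; apply: contraNneq (pP i) => e; apply/hasP; exists u; rewrite ?e.
have sNv u : u \in s -> (u == v) = false.
  by move=> us; apply: contraNF vNs => /eqP <-.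
exists (fun i u => if u == v then g (p i) else c i u); split.
- move=> i u; rewrite inE; case: eqP => [-> //|_] /=; exact: cL.
- move=> i j u; rewrite inE; case: eqP => [_ _|_] /=; last exact: cD.
  by apply: contraNneq => /g_inj /perm_inj ->.
move=> i u w; rewrite !inE.
case: (u =P v) => [->|_]; case: (w =P v) => [->|_] //=; rewrite ?eqxx //.
- by move=> _ ws _; rewrite eq_sym pP.
- by move=> us _ _; rewrite pP.
exact: cP.
Qed.

Fact list_packable_ex (G : sgraph) :
  exists k : nat, (0 < k) && `[< list_packable G k >].
Proof.
by exists #|G|.*2.+1; apply/asboolP; apply: list_packable_double.
Qed.

Fact list_colourable_ex (G : sgraph) :
  exists k : nat, `[< list_colourable G k >].
Proof.
exists #|G|.*2.+1; apply/asboolP => L /list_packable_double[c [cP _]].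
by exists (c ord0).
Qed.

Definition list_chromatic_number (G : sgraph) : nat :=
  ex_minn (list_colourable_ex G).

(* The minimum is over k > 0: the empty packing makes every graph            *)
(* list-packable for k = 0.                                                  *)
Definition list_packing_number (G : sgraph) : nat :=
  ex_minn (list_packable_ex G).

(* Main.v *)
Require Import Defs.
From mathcomp Require Import all_boot.
From mathcomp Require Import all_fingroup finmap boolp.

(** Let q be the list chromatic number and let all lists have size
    k = 1 + Delta + q. An arrangement of the lists into k columns, that is a
    bijection from the columns to L(v) for each v, is a packing as soon as no
    column is monochromatic on an edge; call such a column together with such
    an edge a conflict, and take an arrangement with the fewest conflicts.

    Suppose that column i0 has a conflict on the edge uv, of colour a. Each
    vertex x may exchange its entry in column i0 with its entry in another
    column j, provided that no neighbour of x has the colour of x in column i0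
    at its own place in column j; exchanging with i0 itself changes nothing.
    As the colours at a neighbour are distinct, each neighbour rules out at
    most one column. Ruling out in addition the column where x has colour a
    leaves at least q colours to move into column i0 ([card_swappable]), and
    q-colourability selects them so that they form a proper colouring without
    a. Since a is not used, v may keep a in column i0 and that column remains
    proper.

    After these exchanges, a conflict in a column j <> i0 is either an old
    conflict of that column, or on an edge xy whose ends both exchanged with
    j, hence an old conflict of column i0 on xy. Thus conflicts are only moved
    around and never created. The conflict on uv in column i0 is lost because
    v did not move, so the number of conflicts drops
    ([swap_column_conflicts]), contradicting minimality. *)

Set Implicit Arguments.
Unset Strict Implicit.
Unset Printing Implicit Defensive.

Lemma fset_subset_of_card (K : choiceType) (A : {fset K}) (q : nat) :
  q <= #|` A| -> exists2 B : {fset K}, #|` B| = q & {subset B <= A}.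
Proof.
move=> qA; exists [fset x in take q A]%fset; last first.
  by move=> x; rewrite inE => /mem_take.
by rewrite card_fseq undup_id ?take_uniq ?fset_uniq // size_takel.
Qed.

(** Colourability is about lists of size exactly q; longer lists are cut. *)
Lemma list_colourable_large (G : sgraph) (q : nat) (L : list_assignment G) :
    list_colourable G q -> (forall v, q <= #|` L v|) ->
  exists c, proper_list_colouring L c.
Proof.
move=> Gq leqL; pose B v := sval (cid2 (fset_subset_of_card (leqL v))).
have [|c [cB cP]] := Gq B; first by rewrite /B => v; case: cid2.
by exists c; split=> // v; have := cB v; rewrite /B; case: cid2 => /= ? _; apply.
Qed.

Section Swap.
Variables (G : sgraph) (k : nat).
Implicit Types (c : 'I_k -> G -> nat) (j : G -> 'I_k).

Definition conflicts c : {set 'I_k * G * G} :=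
  [set t | edge t.1.2 t.2 && (c t.1.1 t.1.2 == c t.1.1 t.2)].

Definition swap_column c (i0 : 'I_k) j : 'I_k -> G -> nat :=
  fun i v => c (tperm i0 (j v) i) v.

(** The first hypothesis makes the new column i0 proper; the second says that
    an entry leaving column i0 does not meet its own colour at a neighbour in
    the column it enters. All new conflicts then come from old ones, and the
    conflict on uv gives rise to none. *)
Lemma swap_column_conflicts c i0 j (u v : G) :
    (forall x y, edge x y -> c (j x) x != c (j y) y) ->
    (forall x y, edge x y -> j x != i0 -> c (j x) y != c i0 x) ->
    edge u v -> c i0 u = c i0 v -> j v = i0 ->
  #|conflicts (swap_column c i0 j)| < #|conflicts c|.
Proof.
move=> proper_i0 safe uv cuv jv.
have uvC : (i0, u, v) \in conflicts c by rewrite inE /= uv cuv eqxx.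
rewrite (cardsD1 (i0, u, v) (conflicts c)) uvC add1n ltnS.
(* An old conflict of column i0 on xy can only reappear in the column with
   which x exchanged; the other old conflicts can only stay where they are. *)
pose g (t : 'I_k * G * G) := if t.1.1 == i0 then (j t.1.2, t.1.2, t.2) else t.
apply: leq_trans (leq_imset_card g _).
apply/subset_leq_card/subsetP => -[[i x] y]; rewrite inE /= /swap_column.
case/andP => xy; have [->|i_i0] := eqVneq i i0.
  by rewrite !tpermL (negbTE (proper_i0 _ _ xy)).
have [jx|jx] := eqVneq (j x) i; have [jy|jy] := eqVneq (j y) i.
- rewrite jx jy tpermR => cxy; apply/imsetP; exists (i0, x, y).
    rewrite in_setD1 inE [X in _ && X]/= xy cxy !andbT.
    apply: (contraNneq _ i_i0) => -[_ yv].
    by rewrite -jy yv jv.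
  by rewrite /g /= eqxx jx.
- rewrite jx tpermR tpermD 1?[i0 == i]eq_sym // eq_sym -jx.
  by rewrite (negbTE (safe _ _ xy _)) ?jx.
- rewrite jy tpermR tpermD 1?[i0 == i]eq_sym // -jy.
  by rewrite (negbTE (safe _ _ _ _)) ?jy // edge_sym.
rewrite !tpermD 1?[i0 == i]eq_sym // => cxy; apply/imsetP; exists (i, x, y).
  rewrite in_setD1 inE [X in _ && X]/= xy cxy !andbT.
  by apply: (contraNneq _ i_i0) => -[->].
by rewrite /g /= (negbTE i_i0).
Qed.

(** The columns with which x may exchange its entry in column i0 when the
    colour a is to be avoided there. The neighbours of x never rule out i0
    itself: choosing it moves nothing into another column, and conflicts
    inside the new column i0 are prevented by choosing a proper colouring. *)
Definition swappable c i0 (a : nat) (x : G) : {set 'I_k} :=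
  [set i | (c i x != a) &&
           ((i == i0) || [forall y, edge x y ==> (c i y != c i0 x)])].

(** The colours at any vertex being distinct, the colour of x in column i0
    occurs at most once at each neighbour, and a at most once at x. *)
Lemma card_swappable c i0 a (x : G) :
    (forall y, injective (c^~ y)) ->
  k <= 1 + max_degree G + #|swappable c i0 a x|.
Proof.
move=> c_inj; pose N := enum [set y : G | edge x y].
pose blocked := [set i | has (fun y => c i y == c i0 x) N].
have leN : #|blocked| <= max_degree G.
  apply: leq_trans (leq_bigmax x); rewrite [X in _ <= X]cardE.
  apply: card_has_functional => y i i' /eqP ci /eqP ci'.
  by apply: (c_inj y); rewrite ci ci'.
have lea : #|[set i | c i x == a]| <= 1.
  apply/card_le1P => i; rewrite inE => /eqP ci i'; rewrite !inE.
  by apply/eqP/eqP => [ci'|->//]; apply: (c_inj x); rewrite ci ci'.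
rewrite -[X in X <= _]card_ord -cardsT.
apply: leq_trans (leq_add (leq_add lea leN) (leqnn _)).
apply: leq_trans (leq_add (leq_card_setU _ _) (leqnn _)).
apply: leq_trans (leq_card_setU _ _).
apply/subset_leq_card/subsetP => i _; rewrite !inE.
have [//|_ /=] := eqVneq (c i x) a.
have [//|/= /hasPn nN] := boolP (has _ N).
apply/orP; right; apply/forallP => y; apply/implyP => xy.
by apply: nN; rewrite mem_enum inE.
Qed.

(** The new column i0 is a proper colouring from the lists of swappable
    colours, which avoid the colour a of some conflict in that column, with a
    put back at one end of that conflict. *)
Lemma fewer_conflicts q c :
    list_colourable G q -> 1 + max_degree G + q <= k ->
    (forall y, injective (c^~ y)) -> conflicts c != set0 ->
  exists i0 j, #|conflicts (swap_column c i0 j)| < #|conflicts c|.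
Proof.
move=> Gq leqk c_inj /set0Pn[[[i0 u] v]]; rewrite inE /= => /andP[uv /eqP cuv].
pose a := c i0 v.
pose L x := [fset c i x | i in swappable c i0 a x]%fset.
have leqL x : q <= #|` L x|.
  rewrite card_imfset /=; last by move=> i i'; apply: c_inj.
  rewrite -cardE -(leq_add2l (1 + max_degree G)).
  exact: leq_trans leqk (card_swappable _ _ _ c_inj).
have [f [fL fP]] := list_colourable_large Gq leqL.
have /fin_all_exists[j jP] x : exists i, i \in swappable c i0 a x /\ c i x = f x.
  by have /imfsetP[i /= iS ->] := fL x; exists i.
have fNa x : f x != a.
  by have [] := jP x; rewrite inE => /andP[ja _] <-.
(* No f x equals a, so v can keep a in column i0 instead of receiving f v;
   this is what makes the number of conflicts drop strictly. *)
exists i0, (fun x => if x == v then i0 else j x).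
apply: (@swap_column_conflicts _ _ _ u v) => //; last by rewrite eqxx.
- move=> x y xy; have [xv|_] := eqVneq x v; have [yv|_] := eqVneq y v.
  + by move: xy; rewrite xv yv edge_irrefl.
  + by rewrite xv (jP y).2 eq_sym fNa.
  + by rewrite yv (jP x).2 fNa.
  + by rewrite (jP x).2 (jP y).2 fP.
- move=> x y xy; case: (x == v); first by rewrite eqxx.
  have [+ _] := jP x; rewrite inE => /andP[_ /orP[->//|/forallP/(_ y)]].
  by rewrite xy.
Qed.

End Swap.

(** Arrangements are encoded by a permutation at each vertex, so that they
    form a finite type on which the number of conflicts has a minimum. *)
Lemma list_packable_of_list_colourable (G : sgraph) (q : nat) :
  list_colourable G q -> list_packable G (1 + max_degree G + q).
Proof.
set k := (_ + q) => Gq L Lk.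
pose col (p : {ffun G -> {perm 'I_k}}) (i : 'I_k) v := nth 0 (L v) (p v i).
have col_inj p v : injective ((col p)^~ v).
  move=> i i' /eqP; rewrite nth_uniq ?fset_uniq ?Lk // => /eqP.
  by move/val_inj/perm_inj.
have colL p i v : col p i v \in L v by apply: mem_nth; rewrite -/(size _) Lk.
have [p _ pmin] := @arg_minnP _ [ffun=> 1%g] xpredT
  (fun p => #|conflicts (col p)|) isT.
have p0 : conflicts (col p) = set0.
  apply/eqP/negPn/negP => /(fewer_conflicts Gq (leqnn k) (col_inj p)).
  move=> [i0 [j]]; apply/negP; rewrite -leqNgt.
  suff -> : swap_column (col p) i0 j =
      col [ffun v => tperm i0 (j v) * p v]%g by exact: pmin.
  by apply/funext => i; apply/funext => v; rewrite /swap_column /col ffunE permM.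
exists (col p); split=> [i|i i' v]; last first.
  by apply: contraNneq => /col_inj ->.
split=> [v|u v uv]; first exact: colL.
by have /setP/(_ (i, u, v)) := p0; rewrite !inE /= uv => /negbT.
Qed.

Theorem theorem4 (G : sgraph) :
  list_packing_number G <= 1 + max_degree G + list_chromatic_number G.
Proof.
rewrite /list_packing_number; case: ex_minnP => n _; apply.
rewrite addn_gt0 /=; apply/asboolP/list_packable_of_list_colourable.
by rewrite /list_chromatic_number; case: ex_minnP => q /asboolP.
Qed.
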